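(* Let $Q=(Q,y)$ be a marked finite poset and let $\nu$ be a measure on $\mathfrak{P}$ (the class of finite posets). Then the rule $\alpha\mapsto\nu(\Pi_Q(\alpha))$ defines a measure $\Pi_Q^*(\nu)$ on $\mathfrak{P}$.
   Context: All posets are finite; the empty poset is allowed. An embedding of posets is an injective map $\alpha\colon P\to Q$ with $x\le y\iff\alpha(x)\le\alpha(y)$. Given embeddings $\alpha\colon P\to Q$ and $\beta\colon P\to P'$, an amalgamation of $Q$ and $P'$ over $P$ is a triple $(Q',\alpha',\beta')$ where $Q'$ is a poset and $\alpha'\colon P'\to Q'$, $\beta'\colon Q\to Q'$ are embeddings with $\beta'\circ\alpha=\alpha'\circ\beta$ and $Q'=\mathrm{im}(\alpha')\cup\mathrm{im}(\beta')$; amalgamations are considered up to the evident notion of isomorphism. A measure for (on) $\mathfrak{P}$ valued in a commutative ring $k$ is a rule $\nu$ assigning to each embedding $\alpha\colon P\to Q$ of finite posets a value $\nu(\alpha)\in k$ such that: (a) $\nu(\alpha)=1$ if $\alpha$ is an isomorphism; (b) $\nu(\beta\circ\alpha)=\nu(\beta)\nu(\alpha)$ when the composition is defined; (c) given embeddings $\alpha\colon P\to Q$ and $\beta\colon P\to P'$, with $(Q'_i,\alpha'_i,\beta'_i)$, $1\le i\le r$, the various amalgamations up to isomorphism, $\nu(\alpha)=\sum_{i=1}^r\nu(\alpha'_i)$. A marked poset is a pair $(Q,y)$ with $y\in Q$; $Q^y=Q\setminus\{y\}$. For a poset $P$, $\Pi_Q(P)$ (also written $Q\circ P$) is the poset with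 underlying set $Q^y\sqcup P$, whose order restricts to the given orders on $Q^y$ and $P$, and such that for $a\in Q^y$, $b\in P$: $a<b$ iff $a<y$ in $Q$, and $b<a$ iff $y<a$ in $Q$. For an embedding $\alpha\colon P\to P'$, $\Pi_Q(\alpha)\colon\Pi_Q(P)\to\Pi_Q(P')$ is the embedding given by the identity on $Q^y$ and $\alpha$ on $P$. *)

(* Defs.v *)
From HB Require Import structures.
From mathcomp Require Import all_boot all_order all_algebra.

Set Implicit Arguments.
Unset Strict Implicit.
Unset Printing Implicit Defensive.

Import Order.TTheory GRing.Theory.
Local Open Scope order_scope.

(* A finite poset is a [finPOrderType d]; the display [d] is only a notational
   tag and plays no mathematical role, so a single one is used throughout. *)

Section Embeddings.
Context {d : Order.disp_t}.
Implicit Types P Q R : finPOrderType d.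

Definition is_embedding P Q (f : {ffun P -> Q}) : bool :=
  injectiveb f && [forall x, forall y, (x <= y) == (f x <= f y)].

(* Finite functions satisfying a boolean predicate: embeddings with the same
   values are equal without any axiom. *)
Record embedding P Q := Embedding {
  emb_ffun : {ffun P -> Q};
  emb_ffunP : is_embedding emb_ffun }.

HB.instance Definition _ P Q := [isSub for @emb_ffun P Q].

Definition emb_fun P Q (a : embedding P Q) : P -> Q := emb_ffun a.
Coercion emb_fun : embedding >-> Funclass.

Lemma emb_inj P Q (a : embedding P Q) : injective a.
Proof. by have /andP[/injectiveP a_inj _] := emb_ffunP a. Qed.

Lemma emb_mono P Q (a : embedding P Q) : {mono a : x y / x <= y}.
Proof.
have /andP[_ /forallP aP] := emb_ffunP a.
by move=> x y; rewrite (eqP (forallP (aP x) y)).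
Qed.

Lemma embedding_eqP P Q (a b : embedding P Q) : a =1 b <-> a = b.
Proof. by split=> [ab|->//]; apply/val_inj/ffunP. Qed.

Lemma mk_embedding_subproof P Q (f : P -> Q) (f_inj : injective f)
  (f_mono : {mono f : x y / x <= y}) : is_embedding (finfun f).
Proof.
apply/andP; split; first by apply/injectiveP=> x y; rewrite !ffunE; apply: f_inj.
by apply/forallP=> x; apply/forallP=> y; rewrite !ffunE f_mono.
Qed.

Definition mk_embedding P Q (f : P -> Q) (f_inj : injective f)
    (f_mono : {mono f : x y / x <= y}) : embedding P Q :=
  Embedding (mk_embedding_subproof f_inj f_mono).

Lemma mk_embeddingE P Q (f : P -> Q) f_inj f_mono :
  @mk_embedding P Q f f_inj f_mono =1 f.
Proof. exact: ffunE. Qed.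

Lemma emb_comp_mono P Q R (b : embedding Q R) (a : embedding P Q) :
  {mono (b \o a) : x y / x <= y}.
Proof. by move=> x y /=; rewrite !emb_mono. Qed.

Definition emb_comp P Q R (b : embedding Q R) (a : embedding P Q) :
    embedding P R :=
  mk_embedding (inj_comp (@emb_inj _ _ b) (@emb_inj _ _ a))
               (emb_comp_mono b a).

End Embeddings.

Section Amalgamations.
Context {d : Order.disp_t}.

Record amalgamation (P Q P' : finPOrderType d)
    (a : embedding P Q) (b : embedding P P') := Amalgamation {
  am_poset : finPOrderType d;
  am_a : embedding P' am_poset;
  am_b : embedding Q am_poset;
  am_comm : emb_comp am_b a = emb_comp am_a b;
  am_cover : forall z : am_poset,
    (exists x : P', am_a x = z) \/ (exists x : Q, am_b x = z) }.

Definition am_iso (P Q P' : finPOrderType d)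
    (a : embedding P Q) (b : embedding P P') (A B : amalgamation a b) : Prop :=
  exists phi : embedding (am_poset A) (am_poset B),
    [/\ bijective phi,
        emb_comp phi (am_a A) = am_a B
      & emb_comp phi (am_b A) = am_b B].

(* [A] lists every amalgamation exactly once up to isomorphism. *)
Definition am_enumeration (P Q P' : finPOrderType d)
    (a : embedding P Q) (b : embedding P P')
    (r : nat) (A : 'I_r -> amalgamation a b) : Prop :=
  (forall B : amalgamation a b, exists i : 'I_r, am_iso (A i) B) /\
  (forall i j : 'I_r, am_iso (A i) (A j) -> i = j).

End Amalgamations.

Definition embedding_rule (d : Order.disp_t) (k : Type) : Type :=
  forall P Q : finPOrderType d, embedding P Q -> k.

(* Rings here may be trivial ([comPzRingType]). *)
Record is_measure (d : Order.disp_t) (k : comPzRingType)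
    (nu : embedding_rule d k) : Prop := IsMeasure {
  measure_iso : forall (P Q : finPOrderType d) (a : embedding P Q),
    bijective a -> nu P Q a = 1%R;
  measure_comp : forall (P Q R : finPOrderType d)
      (a : embedding P Q) (b : embedding Q R),
    nu P R (emb_comp b a) = (nu Q R b * nu P Q a)%R;
  measure_amalg : forall (P Q P' : finPOrderType d)
      (a : embedding P Q) (b : embedding P P')
      (r : nat) (A : 'I_r -> amalgamation a b),
    am_enumeration A ->
    nu P Q a = (\sum_(i < r) nu P' (am_poset (A i)) (am_a (A i)))%R }.

Definition pi_poset (d : Order.disp_t) (Q : finPOrderType d) (y : Q)
    (P : finPOrderType d) : Type :=
  ({x : Q | x != y} + P)%type.

Section PiPoset.
Context {d : Order.disp_t} (Q : finPOrderType d) (y : Q).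

Section Order.
Variable P : finPOrderType d.

HB.instance Definition _ := Finite.on (pi_poset y P).

(* Elements of different summands are distinct, so <= and < agree on them. *)
Definition pi_le (u v : pi_poset y P) : bool :=
  match u, v with
  | inl a, inl a' => val a <= val a'
  | inr b, inr b' => b <= b'
  | inl a, inr _ => val a < y
  | inr _, inl a => y < val a
  end.

Lemma pi_le_refl : reflexive pi_le.
Proof. by case=> u /=. Qed.

Lemma pi_le_anti : antisymmetric pi_le.
Proof.
case=> u [] v /=.
- by move/le_anti/val_inj->.
- by case/andP=> h /(lt_trans h); rewrite ltxx.
- by case/andP=> h /(lt_trans h); rewrite ltxx.
- by move/le_anti->.
Qed.

Lemma pi_le_trans : transitive pi_le.
Proof.
case=> v [] u [] w //=.
- exact: le_trans.
- exact: le_lt_trans.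
- by move=> h1 h2; apply: lt_le_trans h1 h2.
- by move=> h1 h2; have := lt_trans h1 h2; rewrite ltxx.
- by move=> h1 h2; exact: ltW (lt_trans h1 h2).
- exact: le_trans.
Qed.

HB.instance Definition _ := Order.Le_isPOrder.Build d (pi_poset y P)
  pi_le_refl pi_le_anti pi_le_trans.

End Order.

Definition pi_fun (P P' : finPOrderType d) (a : embedding P P')
    (u : pi_poset y P) : pi_poset y P' :=
  match u with
  | inl x => inl x
  | inr b => inr (a b)
  end.

Lemma pi_fun_inj P P' (a : embedding P P') : injective (pi_fun a).
Proof. by move=> [u|u] [v|v] //= [] => [->|/emb_inj->]. Qed.

Lemma pi_fun_mono P P' (a : embedding P P') :
  {mono pi_fun a : u v / u <= v}.
Proof. by move=> [u|u] [v|v] //; apply: emb_mono. Qed.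

Definition pi_emb (P P' : finPOrderType d) (a : embedding P P') :
    embedding (pi_poset y P) (pi_poset y P') :=
  mk_embedding (@pi_fun_inj _ _ a) (@pi_fun_mono _ _ a).

End PiPoset.

Definition pi_pullback (d : Order.disp_t) (k : Type)
    (Q : finPOrderType d) (y : Q) (nu : embedding_rule d k) :
    embedding_rule d k :=
  fun P P' a => nu (pi_poset y P) (pi_poset y P') (pi_emb y a).

(* Main.v *)
Require Import Defs.
From HB Require Import structures.
From mathcomp Require Import all_boot all_order all_algebra.

Set Implicit Arguments.
Unset Strict Implicit.
Unset Printing Implicit Defensive.

Import Order.TTheory.
Local Open Scope order_scope.

(** The operation [P |-> Q o P] is functorial on embeddings and preserves
    isomorphisms, so only additivity over amalgamations needs an argument.  For
    that it suffices that, for [a : P -> P1] and [b : P -> P2], inserting into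
    the marked poset induces a bijection between the isomorphism classes of
    amalgamations of [a] and [b] and those of [pi_emb y a] and [pi_emb y b]:
    the additivity relation of the pullback is then the relation that [nu]
    satisfies for [pi_emb y a] and [pi_emb y b].

    The bijection rests on [am_isoP].  In an amalgamation the two given posets
    cover everything and keep their own orders, so its isomorphism class is the
    same thing as the comparisons between points of one and points of the other.
    When the two posets are [Q o P2] and [Q o P1] glued over [Q o P], a point of
    [Q] away from the mark lies in both of them, and its comparisons are thereby
    forced.  The free data are the comparisons between [P2] and [P1], which are
    exactly the data of an amalgamation of [a] and [b].  Hence [pi_amalg]
    reflects isomorphism ([pi_amalg_iso]), and every amalgamation [B] over
    [Q o P] comes from the subposet of [B] formed by the images of [P1] and [P2]
    ([core_amalg], [pi_core_amalg]).  This holds for empty [P] as well. *)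

(** * Isomorphism classes of amalgamations *)

Section AmalgamationIso.
Context {d : Order.disp_t} (P Q P' : finPOrderType d).
Context (a : embedding P Q) (b : embedding P P').
Implicit Types A B : amalgamation a b.

Lemma am_commE A x : am_b A (a x) = am_a A (b x).
Proof. by have /embedding_eqP/(_ x) := am_comm A; rewrite !mk_embeddingE. Qed.

Definition am_join A (s : P' + Q) : am_poset A :=
  match s with inl p => am_a A p | inr q => am_b A q end.

Lemma am_join_surj A z : exists s, am_join A s == z.
Proof.
by case: (am_cover z) => -[x <-]; [exists (inl x) | exists (inr x)].
Qed.

(** An amalgamation is determined by the preorder induced on the disjoint union
    of the two posets; that preorder is prescribed inside each summand. *)
Lemma am_isoP A B :
  am_iso A B <->
  forall p q, (am_a A p <= am_b A q) = (am_a B p <= am_b B q) /\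
              (am_b A q <= am_a A p) = (am_b B q <= am_a B p).
Proof.
split=> [[f [_ /embedding_eqP fa /embedding_eqP fb]] p q|AB].
  by rewrite -fa -fb !mk_embeddingE /= !emb_mono.
have joinE s t : (am_join A s <= am_join A t) = (am_join B s <= am_join B t).
  case: s t => [p|q] [p'|q'] /=; rewrite ?emb_mono //.
    by have [] := AB p q'.
  by have [] := AB p' q.
have joinI s t : am_join A s = am_join A t -> am_join B s = am_join B t.
  by move=> st; apply: le_anti; rewrite -!joinE st lexx.
(* Every point of [A] is a value of [am_join A]; transport it along any
   preimage, the choice being irrelevant by [joinI]. *)
pose f z := am_join B (xchoose (am_join_surj (A := A) z)).
have chooseK z : am_join A (xchoose (am_join_surj z)) = z.
  exact/eqP/(xchooseP (am_join_surj z)).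
have fE s : f (am_join A s) = am_join B s by apply: joinI; apply: chooseK.
have f_mono : {mono f : x y / x <= y}.
  by move=> x y; rewrite -joinE !chooseK.
have f_inj : injective f.
  by move=> x y xy; apply: le_anti; rewrite -!f_mono xy lexx.
pose g z := am_join A (xchoose (am_join_surj (A := B) z)).
have fK : cancel g f.
  by move=> z; rewrite fE; apply/eqP/(xchooseP (am_join_surj z)).
exists (mk_embedding f_inj f_mono); split.
- exists g => z; rewrite mk_embeddingE //.
  by apply: f_inj; rewrite fK.
- by apply/embedding_eqP => p; rewrite !mk_embeddingE /= mk_embeddingE (fE (inl p)).
- by apply/embedding_eqP => q; rewrite !mk_embeddingE /= mk_embeddingE (fE (inr q)).
Qed.

Lemma am_iso_trans A B C : am_iso A B -> am_iso B C -> am_iso A C.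
Proof.
move=> /am_isoP AB /am_isoP BC; apply/am_isoP => p q.
by have [-> ->] := AB p q; apply: BC.
Qed.

End AmalgamationIso.

(** * Induced subposets *)

Section Subposet.
Context {d : Order.disp_t} (T : finPOrderType d) (p : pred T).

(** A named copy of the sigma type, so that the induced order can be attached to
    it with the display of [T]. *)
Definition subposet : Type := {z : T | p z}.

HB.instance Definition _ := SubType.on subposet.
HB.instance Definition _ := Finite.on subposet.
HB.instance Definition _ := [SubChoice_isSubPOrder of subposet by <: with d].

Context (S : finPOrderType d) (f : embedding S T) (fp : forall x, p (f x)).

Definition corestrict_fun (x : S) : subposet := exist _ (f x) (fp x).

Lemma corestrict_inj : injective corestrict_fun.
Proof. by move=> x y /(congr1 val)/emb_inj. Qed.

Lemma corestrict_mono : {mono corestrict_fun : x y / x <= y}.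
Proof. by move=> x y; rewrite -Order.le_val emb_mono. Qed.

Definition corestrict : embedding S subposet :=
  mk_embedding corestrict_inj corestrict_mono.

Lemma val_corestrict x : val (corestrict x) = f x.
Proof. by rewrite mk_embeddingE. Qed.

End Subposet.

(** * Functoriality of insertion into a marked poset *)

Section Pi.
Context {d : Order.disp_t} (Q : finPOrderType d) (y : Q).

Lemma pi_embE (P P' : finPOrderType d) (a : embedding P P') u :
  pi_emb y a u = pi_fun a u.
Proof. exact: mk_embeddingE. Qed.

Lemma pi_emb_bij (P P' : finPOrderType d) (a : embedding P P') :
  bijective a -> bijective (pi_emb y a).
Proof.
case=> g aK gK.
exists (fun u => match u with inl x => inl x | inr z => inr (g z) end).
  by case=> u; rewrite pi_embE //= aK.
by case=> u; rewrite pi_embE //= gK.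
Qed.

Lemma pi_emb_comp (P P' P'' : finPOrderType d) (b : embedding P' P'')
    (a : embedding P P') :
  pi_emb y (emb_comp b a) = emb_comp (pi_emb y b) (pi_emb y a).
Proof.
apply/embedding_eqP => -[u|u]; rewrite mk_embeddingE [RHS]mk_embeddingE /=;
  by rewrite !pi_embE //= mk_embeddingE.
Qed.

Lemma inr_emb_mono (P' : finPOrderType d) :
  {mono (fun p : P' => inr p : pi_poset y P') : p q / p <= q}.
Proof. by []. Qed.

Lemma inr_emb_inj (P' : finPOrderType d) :
  injective (fun p : P' => inr p : pi_poset y P').
Proof. by move=> p q []. Qed.

Definition inr_emb (P' : finPOrderType d) : embedding P' (pi_poset y P') :=
  mk_embedding (@inr_emb_inj P') (@inr_emb_mono P').

(** * Insertion and amalgamations *)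

Section PiAmalgamation.
Context (P P1 P2 : finPOrderType d) (a : embedding P P1) (b : embedding P P2).

Section Insert.
Variable A : amalgamation a b.

Lemma pi_amalg_comm :
  emb_comp (pi_emb y (am_b A)) (pi_emb y a) =
  emb_comp (pi_emb y (am_a A)) (pi_emb y b).
Proof. by rewrite -!pi_emb_comp am_comm. Qed.

Lemma pi_amalg_cover (z : pi_poset y (am_poset A)) :
  (exists u, pi_emb y (am_a A) u = z) \/ (exists u, pi_emb y (am_b A) u = z).
Proof.
case: z => [x|z]; first by left; exists (inl x); rewrite pi_embE.
by case: (am_cover z) => -[x <-]; [left|right]; exists (inr x); rewrite pi_embE.
Qed.

Definition pi_amalg : amalgamation (pi_emb y a) (pi_emb y b) :=
  Amalgamation pi_amalg_comm pi_amalg_cover.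

End Insert.

(** Isomorphism over [Q o P] only has to be tested on the inserted posets: a
    point of [Q] away from the mark belongs to both sides, so comparing it with
    a point of one side takes place within that side. *)
Lemma am_iso_piP (A B : amalgamation (pi_emb y a) (pi_emb y b)) :
  am_iso A B <->
  forall p q, (am_a A (inr p) <= am_b A (inr q)) =
              (am_a B (inr p) <= am_b B (inr q)) /\
              (am_b A (inr q) <= am_a A (inr p)) =
              (am_b B (inr q) <= am_a B (inr p)).
Proof.
split=> [/am_isoP AB p q|AB]; first exact: AB.
have shared (C : amalgamation (pi_emb y a) (pi_emb y b)) x :
    am_a C (inl x) = am_b C (inl x).
  by have := am_commE C (inl x); rewrite !pi_embE.
(* A shared point is moved to the side of the other point, where the order is
   prescribed by the embedding property. *)
apply/am_isoP => -[x|p] [x'|q]; rewrite ?shared -?shared ?emb_mono //.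
by rewrite !shared !emb_mono.
Qed.

(** The comparisons tested by [am_iso_piP] take place inside the inserted poset,
    where they are those tested by [am_isoP] before insertion. *)
Lemma pi_amalg_iso (A B : amalgamation a b) :
  am_iso (pi_amalg A) (pi_amalg B) <-> am_iso A B.
Proof.
split=> [/am_iso_piP|/am_isoP] AB; first apply/am_isoP; last apply/am_iso_piP;
  move=> p q; have := AB p q; by rewrite /= !pi_embE.
Qed.

Section Core.
Variable B : amalgamation (pi_emb y a) (pi_emb y b).

(** The points of [B] that do not come from [Q] away from the mark. *)
Definition in_core : pred (am_poset B) :=
  [pred z | [exists p, am_a B (inr p) == z] || [exists q, am_b B (inr q) == z]].

Definition core_emb_a := emb_comp (am_a B) (inr_emb P2).
Definition core_emb_b := emb_comp (am_b B) (inr_emb P1).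

Lemma core_emb_aE p : core_emb_a p = am_a B (inr p).
Proof. by rewrite mk_embeddingE /= mk_embeddingE. Qed.

Lemma core_emb_bE q : core_emb_b q = am_b B (inr q).
Proof. by rewrite mk_embeddingE /= mk_embeddingE. Qed.

Lemma in_core_a p : in_core (core_emb_a p).
Proof. by rewrite core_emb_aE; apply/orP; left; apply/existsP; exists p. Qed.

Lemma in_core_b q : in_core (core_emb_b q).
Proof. by rewrite core_emb_bE; apply/orP; right; apply/existsP; exists q. Qed.

Lemma core_comm :
  emb_comp (corestrict in_core_b) a = emb_comp (corestrict in_core_a) b.
Proof.
apply/embedding_eqP => x; apply: val_inj; rewrite mk_embeddingE [in RHS]mk_embeddingE /=.
rewrite !val_corestrict core_emb_aE core_emb_bE.
by have := am_commE B (inr x); rewrite !pi_embE.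
Qed.

Lemma core_cover (z : subposet in_core) :
  (exists p, corestrict in_core_a p = z) \/
  (exists q, corestrict in_core_b q = z).
Proof.
case/orP: (valP z) => /existsP[x /eqP xz]; [left|right]; exists x; apply: val_inj;
  by rewrite val_corestrict ?core_emb_aE ?core_emb_bE.
Qed.

Definition core_amalg : amalgamation a b := Amalgamation core_comm core_cover.

(** The order of the core is that of [B], so the comparisons between [P2] and
    [P1] agree; by [am_iso_piP] nothing else can differ. *)
Lemma pi_core_amalg : am_iso (pi_amalg core_amalg) B.
Proof.
apply/am_iso_piP => p q; rewrite /= !pi_embE /=.
by rewrite -core_emb_aE -core_emb_bE -(val_corestrict in_core_a)
  -(val_corestrict in_core_b) !Order.le_val.
Qed.

End Core.

(** Every isomorphism class is met because an amalgamation is recovered from its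
    core, and met only once because insertion reflects isomorphism. *)
Lemma pi_amalg_enumeration r (A : 'I_r -> amalgamation a b) :
  am_enumeration A -> am_enumeration (fun i => pi_amalg (A i)).
Proof.
case=> A_all A_uniq; split=> [B|i j /pi_amalg_iso]; last exact: A_uniq.
have [i Ai] := A_all (core_amalg B); exists i.
by apply: am_iso_trans (pi_core_amalg B); apply/pi_amalg_iso.
Qed.

End PiAmalgamation.
End Pi.

Theorem corollary7p2 (d : Order.disp_t) (k : comPzRingType)
    (Q : finPOrderType d) (y : Q) (nu : embedding_rule d k)
    (nu_measure : is_measure nu) :
  is_measure (pi_pullback y nu).
Proof.
split=> [P P' a a_bij|P P' P'' a b|P P1 P2 a b r A A_enum]; rewrite /pi_pullback.
- exact/(measure_iso nu_measure)/pi_emb_bij.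
- by rewrite pi_emb_comp (measure_comp nu_measure).
- exact: (measure_amalg nu_measure (pi_amalg_enumeration y A_enum)).
Qed.
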